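(* Let $G_1,G_2$ be groups with a common virtually cyclic subgroup $G_0$, and let $G=G_1*_{G_0} G_2$. Suppose that we are given normal subgroups $N_i\lhd G_i$, $i=1,2$, and $N\lhd G$, such that $G_i/N_i$, $i=1,2$, and $G/N$ are finitely generated and virtually abelian. If $G_0$ is a virtual retract of $G_i$, for $i=1,2$, then for arbitrary finitely generated virtually abelian subgroups $H_i\leqslant G_i$ such that $H_i$ is a virtual retract of $G_i$, $i=1,2$, there exist a finitely generated virtually abelian group $P$ and a homomorphism $\psi:G\to P$ such that \begin{itemize} \item $\ker\psi\cap G_i\subseteq N_i$, for each $i=1,2$; \item $\ker\psi\subseteq N$; \item $\psi$ is injective on $G_0$ and on each subgroup $H_i$, $i=1,2$. \end{itemize}
   Context: A subgroup $H$ of a group $G$ is a virtual retract of $G$ if there are a finite index subgroup $K\leqslant G$ containing $H$ and a homomorphism $\rho:K\to H$ with $\rho|_H=\mathrm{Id}_H$. A group is virtually abelian (virtually cyclic) if it has a finite index abelian (respectively, cyclic) subgroup; finite groups are virtually cyclic. *)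

(* Defs.v *)
From HB Require Import structures.
From mathcomp Require Import all_boot.
From mathcomp Require Import boolp classical_sets functions cardinality.

Set Implicit Arguments.
Unset Strict Implicit.
Unset Printing Implicit Defensive.

Local Open Scope classical_set_scope.
Local Open Scope group_scope.
Local Open Scope quotient_scope.

(* Groups are [groupType]s and need not be finite. Subgroups are sets of
   elements; a property of a group [G] itself is that of [[set: G]]. *)

Section Subgroups.
Variable G : groupType.
Implicit Types A H K S : set G.

Definition subgroup H : Prop := group_closed [in H].

Definition generated S : set G := smallest subgroup S.

Definition finitely_generated H : Prop :=
  exists2 S : set G, finite_set S & H = generated S.

Definition lcoset (x : G) K : set G := [set x * k | k in K].

(* [K] has finite index in [H] (used with [K] a subgroup of [H]). *)
Definition finite_index K H : Prop :=
  finite_set [set lcoset x K | x in H].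

Definition abelian_set A : Prop := {in A &, forall x y, commute x y}.

Definition cyclic_set A : Prop := exists x : G, A = generated [set x].

Definition virtually (P : set G -> Prop) H : Prop :=
  exists A : set G, [/\ subgroup A, A `<=` H, finite_index A H & P A].

Definition virtually_abelian := virtually abelian_set.

Definition virtually_cyclic := virtually cyclic_set.

(* The retraction [rho : K -> H] is given by a function on [G] of which only
   the values on [K] matter. *)
Definition virtual_retract H : Prop :=
  exists K : set G, [/\ subgroup K, H `<=` K, finite_index K [set: G] &
    exists rho : G -> G,
      [/\ {in K, forall x, rho x \in H},
          {in K &, {morph rho : x y / x * y}} &
          {in H, forall x, rho x = x}]].

End Subgroups.

Record normalSubgroup (G : groupType) := NormalSubgroup {
  normal_set :> set G;
  normal_subgroup : subgroup normal_set;
  normal_conj : forall g x : G, normal_set x -> normal_set (x ^ g)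
}.

Section QuotientGroup.
Variables (G : groupType) (N : normalSubgroup G).

Let Ns : set G := N.

Let N1 : Ns 1.
Proof. by have [/set_mem] := normal_subgroup N. Qed.

Let NF (x y : G) : Ns x -> Ns y -> Ns (x / y).
Proof.
have [_ NF] := normal_subgroup N.
by move=> /mem_set Nx /mem_set Ny; apply: set_mem; apply: NF.
Qed.

Let NV (x : G) : Ns x -> Ns x^-1.
Proof. by move=> Nx; rewrite -div1g; apply: NF. Qed.

Let NM (x y : G) : Ns x -> Ns y -> Ns (x * y).
Proof. by move=> Nx /NV Ny; rewrite -[y]invgK; apply: NF. Qed.

Definition coset_rel (x y : G) : bool := x^-1 * y \in (N : set G).

Fact coset_rel_refl : reflexive coset_rel.
Proof. by move=> x; rewrite /coset_rel mulVg; apply: mem_set. Qed.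

Fact coset_rel_sym : symmetric coset_rel.
Proof.
by move=> x y; apply/idP/idP => /set_mem /NV h; apply: mem_set;
  rewrite invgM invgK in h.
Qed.

Fact coset_rel_trans : transitive coset_rel.
Proof.
move=> y x z /set_mem hxy /set_mem hyz; apply: mem_set.
by have := NM hxy hyz; rewrite -mulgA mulVKg.
Qed.

Canonical coset_equiv :=
  EquivRel coset_rel coset_rel_refl coset_rel_sym coset_rel_trans.

Definition quotient_group := {eq_quot coset_equiv}.

HB.instance Definition _ := Choice.on quotient_group.
HB.instance Definition _ := EqQuotient.on quotient_group.

Definition quotient_proj (x : G) : quotient_group := \pi_quotient_group x.

Let projP (x y : G) :
  reflect (quotient_proj x = quotient_proj y) (coset_rel x y).
Proof. by apply: (iffP idP) => [h|/eqquotP //]; apply/eqquotP. Qed.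

Let reprP (u : quotient_group) : quotient_proj (repr u) = u.
Proof. exact: reprK. Qed.

Definition quotient_one : quotient_group := quotient_proj 1.

Definition quotient_inv (u : quotient_group) : quotient_group :=
  quotient_proj (repr u)^-1.

Definition quotient_mul (u v : quotient_group) : quotient_group :=
  quotient_proj (repr u * repr v).

Let projM (x y : G) :
  quotient_mul (quotient_proj x) (quotient_proj y) = quotient_proj (x * y).
Proof.
apply/projP; set x' := repr _; set y' := repr _.
have /projP/set_mem hx : quotient_proj x' = quotient_proj x by rewrite reprP.
have /projP/set_mem hy : quotient_proj y' = quotient_proj y by rewrite reprP.
apply: mem_set.
have -> : (x' * y')^-1 * (x * y) = (x'^-1 * x) ^ y' * (y'^-1 * y).
  by rewrite /conjg invgM !mulgA mulgK.
by apply: NM => //; apply: normal_conj.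
Qed.

Let projV (x : G) : quotient_inv (quotient_proj x) = quotient_proj x^-1.
Proof.
apply/projP; set x' := repr _.
have /projP/set_mem hx : quotient_proj x' = quotient_proj x by rewrite reprP.
apply: mem_set.
have -> : (x'^-1)^-1 * x^-1 = ((x'^-1 * x)^-1) ^ (x'^-1).
  by rewrite /conjg invgM !invgK !mulgA mulgK.
by apply: normal_conj; apply: NV.
Qed.

Fact quotient_mulA : associative quotient_mul.
Proof.
by move=> u v w; rewrite -(reprP u) -(reprP v) -(reprP w) !projM mulgA.
Qed.

Fact quotient_mul1g : left_id quotient_one quotient_mul.
Proof. by move=> u; rewrite -(reprP u) projM mul1g. Qed.

Fact quotient_mulg1 : right_id quotient_one quotient_mul.
Proof. by move=> u; rewrite -(reprP u) projM mulg1. Qed.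

Fact quotient_mulVg : left_inverse quotient_one quotient_inv quotient_mul.
Proof. by move=> u; rewrite -(reprP u) projV projM mulVg. Qed.

Fact quotient_mulgV : right_inverse quotient_one quotient_inv quotient_mul.
Proof. by move=> u; rewrite -(reprP u) projV projM mulgV. Qed.

HB.instance Definition _ := isGroup.Build quotient_group quotient_mulA
  quotient_mul1g quotient_mulg1 quotient_mulVg quotient_mulgV.

Fact quotient_proj_is_multiplicative : {morph quotient_proj : x y / x * y}.
Proof. by move=> x y; rewrite -projM. Qed.

HB.instance Definition _ :=
  isMultiplicative.Build G quotient_group quotient_proj
    quotient_proj_is_multiplicative.

End QuotientGroup.

(* [G], with the maps [i1] and [i2], is the free product of [G1] and [G2] with
   amalgamation along [j1 : G0 -> G1] and [j2 : G0 -> G2], i.e. their pushout.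
   When [j1] and [j2] are injective, so are [i1] and [i2]. *)
Definition is_amalgam (G0 G1 G2 G : groupType)
    (j1 : {multiplicative G0 -> G1}) (j2 : {multiplicative G0 -> G2})
    (i1 : {multiplicative G1 -> G}) (i2 : {multiplicative G2 -> G}) : Prop :=
  i1 \o j1 =1 i2 \o j2 /\
  forall (T : groupType)
    (f1 : {multiplicative G1 -> T}) (f2 : {multiplicative G2 -> T}),
    f1 \o j1 =1 f2 \o j2 ->
    (exists f : {multiplicative G -> T}, f \o i1 =1 f1 /\ f \o i2 =1 f2) /\
    (forall f g : {multiplicative G -> T},
      f \o i1 =1 g \o i1 -> f \o i2 =1 g \o i2 -> f =1 g).

Definition ker (G P : groupType) (f : {multiplicative G -> P}) : set G :=
  [set x | f x = 1].

(* Main.v *)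
(* It is enough to give, for each [i], a map from [G] to a finitely generated
   virtually abelian group whose kernel meets [G_i] in a subgroup of [N_i]
   avoiding [H_i] and [G_0], and then to multiply these two maps with
   [G -> G/N].

   Pulling back along the retractions and along [G_i -> G_i/N_i] gives a normal
   subgroup [B_i] of finite index in [G_i] and finitely many homomorphisms
   [B_i -> Z] whose common kernel is as small as required. Since [G_0] is
   virtually cyclic, the [B_i] can be shrunk until both meet [G_0] in the same
   subgroup [<w>].

   Given [f_i : B_i -> Z], let [B_1] act on [Z] by the translations [f_1] and
   induce this action to [G_1]: it lives on copies of [Z] indexed by the cosets
   of [B_1], which are the product of [Gamma = G_0/<w>], permuted by [G_0], and
   of the set [T_1] of double cosets; likewise for [G_2]. Both groups then act
   on copies of [Z] indexed by [Gamma x T_1 x T_2]: an element of [G_1] through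
   the first two factors, its translations being multiplied by
   [c_2 = f_2 (w ^ t_2)], and symmetrically. On [w] both are translations by
   [f_1 (w ^ t_1) f_2 (w ^ t_2)], so the two actions agree on [G_0] and define a
   homomorphism from [G] to the wreath product [Z wr Sym (Gamma x T_1 x T_2)];
   on [G_1] its kernel lies in [ker f_1] as soon as [c_2] does not vanish at [1].
   If [w = 1], one takes [c_2 = 1] and [f_2 = 0]. *)

Require Import Defs.
From HB Require Import structures.
From mathcomp Require Import all_boot perm order ssralg ssrnum ssrint intdiv.
From mathcomp Require Import zify.
From mathcomp Require Import boolp classical_sets functions cardinality.

Set Implicit Arguments.
Unset Strict Implicit.
Unset Printing Implicit Defensive.

Local Open Scope classical_set_scope.
Local Open Scope group_scope.

(** * Subgroups and finite index *)

Section SubgroupBasics.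
Variables (G : groupType) (H : set G).

Lemma subgroupP :
  H 1 -> (forall x y, H x -> H y -> H (x * y^-1)) -> subgroup H.
Proof.
move=> h1 hF; split; first exact: mem_set.
by move=> x y /set_mem hx /set_mem hy; apply: mem_set; apply: hF.
Qed.

Hypothesis sgH : subgroup H.

Lemma subgroup1 : H 1.
Proof. by have [/set_mem] := sgH. Qed.

Lemma subgroupF x y : H x -> H y -> H (x * y^-1).
Proof.
have [_ hF] := sgH.
by move=> /mem_set hx /mem_set hy; apply: set_mem; apply: hF.
Qed.

Lemma subgroupV x : H x -> H x^-1.
Proof. by move=> hx; rewrite -div1g; apply: subgroupF => //; apply: subgroup1. Qed.

Lemma subgroupM x y : H x -> H y -> H (x * y).
Proof. by move=> hx /subgroupV hy; rewrite -[y]invgK; apply: subgroupF. Qed.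

Lemma subgroupX x n : H x -> H (x ^+ n).
Proof.
move=> hx; elim: n => [|n IH]; first exact: subgroup1.
by rewrite expgS; apply: subgroupM.
Qed.

Lemma subgroupMl x y : H x -> H (x * y) -> H y.
Proof.
by move=> hx hxy; rewrite -[y](mulKg x); apply: subgroupM => //; apply: subgroupV.
Qed.

End SubgroupBasics.

Lemma subgroupI (G : groupType) (H K : set G) :
  subgroup H -> subgroup K -> subgroup (H `&` K).
Proof.
move=> sH sK; apply: subgroupP; first by split; apply: subgroup1.
by move=> x y [hx kx] [hy ky]; split; apply: subgroupF.
Qed.

Lemma generated_subgroup (G : groupType) (S : set G) : subgroup (generated S).
Proof.
apply: subgroupP; first by move=> K [sK _]; apply: subgroup1.
by move=> x y hx hy K [sK hK]; apply: subgroupF => //; [apply: hx | apply: hy].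
Qed.

Lemma generated_sub (G : groupType) (S K : set G) :
  subgroup K -> S `<=` K -> generated S `<=` K.
Proof. by move=> sK hS x; apply. Qed.

Lemma sub_generated (G : groupType) (S : set G) : S `<=` generated S.
Proof. by move=> x Sx K [_]; apply. Qed.

Lemma gmorph1 (G P : groupType) (f : {multiplicative G -> P}) : f 1 = 1.
Proof. by apply: (@mulgI _ (f 1)); rewrite -gmulfM !mulg1. Qed.

Lemma gmorphV (G P : groupType) (f : {multiplicative G -> P}) x :
  f x^-1 = (f x)^-1.
Proof. by apply: (@mulgI _ (f x)); rewrite -gmulfM !mulgV gmorph1. Qed.

Lemma gmorphF (G P : groupType) (f : {multiplicative G -> P}) x y :
  f (x * y^-1) = f x * (f y)^-1.
Proof. by rewrite gmulfM gmorphV. Qed.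

Lemma gmorphX (G P : groupType) (f : {multiplicative G -> P}) x n :
  f (x ^+ n) = f x ^+ n.
Proof. by elim: n => [|n IH]; rewrite ?gmorph1 // !expgS gmulfM IH. Qed.

(* Finite index of [K] in [H], witnessed by a finite-valued map separating the
   left cosets; unlike [finite_index] it passes readily to intersections,
   preimages and towers. *)
Definition fin_idx (G : groupType) (K H : set G) : Prop :=
  exists (T : finType) (F : G -> T),
    forall x y, H x -> H y -> F x = F y -> K (x^-1 * y).

Section FiniteIndex.
Variable G : groupType.
Implicit Types H K M : set G.

Lemma fin_idxP K H : subgroup K -> finite_index K H <-> fin_idx K H.
Proof.
move=> sK; split.
  move=> /finite_seqP [s hs].
  exists 'I_(size s).+1, (fun x => inord (index (lcoset x K) s)) => x y hx hy.
  have hin z : H z -> lcoset z K \in s.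
    by move=> hz; have : [set` s] (lcoset z K) by rewrite -hs; exists z.
  move=> /(congr1 val); rewrite /= !inordK ?ltnS ?index_size //.
  move=> /(congr1 (nth set0 s)); rewrite !nth_index ?hin // => e.
  have : lcoset y K y by exists 1; [apply: subgroup1 | rewrite mulg1].
  by rewrite -e => -[k hk <-]; rewrite mulKg.
move=> [T [F hF]]; rewrite /finite_index.
pose h t := lcoset (xget 1 [set x | H x /\ F x = t]) K.
apply: (@sub_finite_set _ _ [set h t | t in [set: T]]); last first.
  by apply: finite_image; apply: finite_finset.
move=> _ [x hx <-]; exists (F x) => //; rewrite /h.
case: xgetP => [y _ [hy e]|/(_ x)]; last by case.
have hk := hF _ _ hy hx e.
apply/seteqP; split => z [k Kk <-].
  by exists (x^-1 * y * k); rewrite ?mulgA ?mulgV ?mul1g //; apply: subgroupM => //;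
    have := subgroupV sK hk; rewrite invgM invgK.
by exists (y^-1 * x * k); [apply: subgroupM | rewrite !mulgA mulgV mul1g].
Qed.

Lemma fin_idx_trans K H M :
  (forall x, H x -> M x) -> fin_idx K H -> fin_idx H M -> fin_idx K M.
Proof.
move=> hHM [T [F hF]] [U [E hE]].
pose r u := xget 1 [set x | M x /\ E x = u].
have hr x : M x -> H ((r (E x))^-1 * x).
  move=> hx; rewrite /r; case: xgetP => [y _ [hy e]|/(_ x)]; last by case.
  exact: hE.
exists (T * U)%type, (fun x => (F ((r (E x))^-1 * x), E x)) => x y hx hy [+ e].
move=> /hF - /(_ (hr _ hx)); rewrite e => /(_ (hr _ hy)).
by rewrite invgM invgK !mulgA mulgK.
Qed.

Lemma fin_idxI K1 K2 H :
  fin_idx K1 H -> fin_idx K2 H -> fin_idx (K1 `&` K2) H.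
Proof.
move=> [T [F hF]] [U [E hE]].
exists (T * U)%type, (fun x => (F x, E x)) => x y hx hy [e e'].
by split; [apply: hF | apply: hE].
Qed.

Lemma fin_idx_refl H : subgroup H -> fin_idx H H.
Proof.
move=> sH; exists unit, (fun=> tt) => x y hx hy _.
by apply: subgroupM => //; apply: subgroupV.
Qed.

Definition core K : set G := [set x | forall g, K (x ^ g)].

Lemma core_sub K : core K `<=` K.
Proof. by move=> x /(_ 1); rewrite conjg1. Qed.

Lemma core_subgroup K : subgroup K -> subgroup (core K).
Proof.
move=> sK; apply: subgroupP; first by move=> g; rewrite conj1g; apply: subgroup1.
by move=> x y hx hy g; rewrite conjMg conjVg; apply: subgroupF.
Qed.

Lemma core_conj K x g : core K x -> core K (x ^ g).
Proof. by move=> hx h; rewrite -conjgM. Qed.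

(** It suffices to conjugate by one representative [r t] per label, because [g] differs from the one
    sharing its label by a factor in [K]. When [x] and [y] agree on all labels [F (x * r t)], every
    conjugate of [x^-1 * y] therefore lies in [K]. *)
Lemma core_fin_idx K :
  subgroup K -> fin_idx K [set: G] -> fin_idx (core K) [set: G].
Proof.
move=> sK [T [F hF]].
pose r t := xget 1 [set x | F x = t].
have hr x : F (r (F x)) = F x.
  by rewrite /r; case: xgetP => [y _ //|/(_ x)]; case.
exists {ffun T -> T}, (fun x => [ffun t => F (x * r t)]) => x y _ _ e g.
have /hF - /(_ I I) : F (x * r (F g)) = F (y * r (F g)).
  by move/ffunP/(_ (F g)): e; rewrite !ffunE.
have /hF - /(_ I I) := hr g; set s := r _ => hk hs.
have -> : (x^-1 * y) ^ g = (s^-1 * g)^-1 * ((x * s)^-1 * (y * s)) * (s^-1 * g).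
  by rewrite /conjg !invgM !invgK !mulgA !mulgK.
by apply: subgroupM => //; apply: subgroupM => //; apply: subgroupV.
Qed.

End FiniteIndex.

Lemma fin_idx_preim (G M : groupType) (rho : G -> M) (K : set G) (A H : set M) :
  (forall x y, K x -> K y -> rho (x^-1 * y) = (rho x)^-1 * rho y) ->
  subgroup K -> (forall x, K x -> H (rho x)) ->
  fin_idx A H -> fin_idx (K `&` rho @^-1` A) K.
Proof.
move=> hrho sK hKH [T [F hF]]; exists T, (F \o rho) => x y hx hy e; split.
  by apply: subgroupM => //; apply: subgroupV.
by rewrite /= hrho //; apply: hF => //; apply: hKH.
Qed.

(** * Homomorphisms to the integers on finite-index subgroups *)

Definition zpow (G : groupType) (x : G) (k : int) : G :=
  match k with Posz n => x ^+ n | Negz n => (x ^+ n.+1)^-1 end.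

Section IntegerPowers.
Variable G : groupType.
Implicit Types (x y : G) (k l : int).

Lemma zpowB x (m n : nat) : zpow x (m%:Z - n%:Z)%R = x ^+ m * (x ^+ n)^-1.
Proof.
case: (leqP n m) => h.
  by rewrite subzn //= expgnFr.
have -> : (m%:Z - n%:Z)%R = Negz (n - m).-1 by lia.
have -> : n = (n - m) + m by lia.
rewrite expgnDr invgM mulgA mulgV mul1g /=; congr (_ ^+ _)^-1; lia.
Qed.

Lemma zpowD x k l : zpow x (k + l)%R = zpow x k * zpow x l.
Proof.
have dec (j : int) : exists m n : nat, j = (m%:Z - n%:Z)%R.
  by case: j => n; [exists n, 0; lia | exists 0, n.+1; lia].
have [m [n ->]] := dec k; have [p [q ->]] := dec l.
have -> : ((m%:Z - n%:Z) + (p%:Z - q%:Z) = (m + p)%:Z - (n + q)%:Z)%R by lia.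
rewrite !zpowB !expgnDr invgM -!mulgA; congr (_ * _).
rewrite mulgA; symmetry.
by apply: commuteM; [|apply: commuteV]; apply/commute_sym/commuteV/commuteX2.
Qed.

Lemma zpowN x k : zpow x (- k)%R = (zpow x k)^-1.
Proof. by apply: (@mulgI _ (zpow x k)); rewrite -zpowD GRing.subrr mulgV. Qed.

Lemma zpowMn x k (n : nat) : zpow x (k * n%:Z)%R = zpow x k ^+ n.
Proof.
elim: n => [|n IH]; first by rewrite GRing.mulr0.
by rewrite expgS -IH -zpowD; congr zpow; lia.
Qed.

Lemma zpowM x k l : zpow x (k * l)%R = zpow (zpow x k) l.
Proof.
case: l => n; first exact: zpowMn.
by rewrite NegzE GRing.mulrN !zpowN zpowMn.
Qed.

Lemma commute_zpow x y k : commute x y -> commute x (zpow y k).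
Proof.
by move=> c; case: k => n; rewrite /zpow; [|apply: commuteV]; apply: commuteX.
Qed.

Lemma subgroup_zpow (H : set G) x k : subgroup H -> H x -> H (zpow x k).
Proof.
by move=> sH hx; case: k => n; rewrite /zpow; [|apply: subgroupV => //];
  apply: subgroupX.
Qed.

Lemma zpow_subgroup x : subgroup (range (zpow x)).
Proof.
apply: subgroupP; first by exists 0%R.
by move=> _ _ [k _ <-] [l _ <-]; exists (k - l)%R; rewrite ?zpowD ?zpowN.
Qed.

Lemma generated_zpow x : generated [set x] = range (zpow x).
Proof.
apply/seteqP; split.
  by apply: (generated_sub (zpow_subgroup x)) => _ ->; exists 1%R.
move=> _ [k _ <-]; apply: (subgroup_zpow k (@generated_subgroup _ _)).
exact: sub_generated.
Qed.

Lemma conj_zpow x y k : zpow x k ^ y = zpow (x ^ y) k.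
Proof. by case: k => n; rewrite /zpow ?conjVg conjXg. Qed.

End IntegerPowers.

Lemma gmorph_zpow (G M : groupType) (f : {multiplicative G -> M}) x k :
  f (zpow x k) = zpow (f x) k.
Proof.
by case: k => n; rewrite /zpow ?gmorphV gmorphX.
Qed.

Definition zhom (G : groupType) (B : set G) (f : G -> int) : Prop :=
  forall x y, B x -> B y -> f (x * y) = (f x + f y)%R.

Section IntegerHoms.
Variables (G : groupType) (B : set G) (f : G -> int).
Hypotheses (sB : subgroup B) (hf : zhom B f).

Lemma zhom1 : f 1 = 0%R.
Proof.
have b1 := subgroup1 sB.
by apply: (GRing.addrI (f 1)); rewrite -hf // mulg1 GRing.addr0.
Qed.

Lemma zhomV x : B x -> f x^-1 = (- f x)%R.
Proof.
move=> bx; apply: (GRing.addrI (f x)).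
by rewrite -hf ?mulgV ?zhom1 ?GRing.subrr //; apply: subgroupV.
Qed.

Lemma zhomX x n : B x -> f (x ^+ n) = (f x * n%:Z)%R.
Proof.
move=> bx; elim: n => [|n IH]; first by rewrite zhom1 GRing.mulr0.
by rewrite expgS hf ?IH //; [lia | apply: subgroupX].
Qed.

Lemma zhom_zpow x k : B x -> f (zpow x k) = (f x * k)%R.
Proof.
move=> bx; case: k => n; rewrite /zpow; first exact: zhomX.
by rewrite zhomV ?zhomX //; [lia | apply: subgroupX].
Qed.

End IntegerHoms.

Lemma zhom_sub (G : groupType) (B B' : set G) f :
  B' `<=` B -> zhom B f -> zhom B' f.
Proof. by move=> h hf x y /h bx /h bY; apply: hf. Qed.

(** [Q] is an arbitrary set, so that trivial intersection with a given subgroup can be imposed as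
    well. For a subgroup [H] and [Q] trivial, this says that [H] is virtually free abelian of finite
    rank. *)
Definition int_separated (G : groupType) (H Q : set G) : Prop :=
  exists (B : set G) (I : finType) (f : I -> G -> int),
    [/\ subgroup B, B `<=` H, fin_idx B H, forall i, zhom B (f i) &
        forall x, B x -> (forall i, f i x = 0%R) -> Q x].

Section Separation.
Variable G : groupType.
Implicit Types H A Q : set G.

Lemma int_separated_fin_idx A H Q :
  A `<=` H -> fin_idx A H -> int_separated A Q -> int_separated H Q.
Proof.
move=> hAH iA [B [I [f [sB hBA iB hf hQ]]]].
by exists B, I, f; split=> //; [apply: subset_trans hAH | apply: fin_idx_trans iA].
Qed.

Lemma int_separatedI H Q1 Q2 :
  int_separated H Q1 -> int_separated H Q2 -> int_separated H (Q1 `&` Q2).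
Proof.
move=> [B [I [f [sB hB iB hf hQ]]]] [C [J [g [sC hC iC hg hQ']]]].
exists (B `&` C), (I + J)%type,
  (fun k => match k with inl i => f i | inr j => g j end); split.
- exact: subgroupI.
- by move=> x [/hB].
- exact: fin_idxI.
- by case=> i; [apply: zhom_sub (hf i) | apply: zhom_sub (hg i)]; move=> x [].
- move=> x [bx cx] h; split; first by apply: hQ => // i; apply: (h (inl i)).
  by apply: hQ' => // i; apply: (h (inr i)).
Qed.

Lemma int_separated_preim (M : groupType) (K : set G) (rho : G -> M)
    (H Q : set M) :
  subgroup K -> (forall x y, K x -> K y -> rho (x * y) = rho x * rho y) ->
  (forall x, K x -> H (rho x)) -> int_separated H Q ->
  int_separated K (rho @^-1` Q).
Proof.
move=> sK hrho hKH [B [I [f [sB hB iB hf hQ]]]].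
have rho1 : rho 1 = 1.
  apply: (@mulgI _ (rho 1)).
  by rewrite -hrho ?mulg1 //; apply: subgroup1.
have rhoV x : K x -> rho x^-1 = (rho x)^-1.
  move=> kx; apply: (@mulgI _ (rho x)).
  by rewrite -hrho ?mulgV ?rho1 //; apply: subgroupV.
exists (K `&` rho @^-1` B), I, (fun i => f i \o rho); split.
- apply: subgroupP; first by split; rewrite /= ?rho1; apply: subgroup1.
  move=> x y [kx bx] [ky bY]; have kV := subgroupV sK ky; split.
    exact: subgroupM.
  by rewrite /= hrho // rhoV //; apply: subgroupF.
- by move=> x [].
- apply: (fin_idx_preim _ sK hKH iB) => x y kx ky.
  by rewrite hrho ?rhoV //; apply: subgroupV.
- by move=> i x y [kx bx] [ky bY]; rewrite /= hrho // hf.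
- by move=> x [kx bx] h; apply: hQ.
Qed.

Lemma sub_center_generated (a : G) (s : seq G) :
  (forall x, x \in s -> commute a x) ->
  forall c, generated [set` s] c -> commute a c.
Proof.
move=> h; apply: (@generated_sub _ _ [set c | commute a c]) h.
apply: subgroupP; first exact: commute1.
by move=> x y hx hy; apply: commuteM => //; apply: commuteV.
Qed.

(** The powers of [a] centralise [<s>], so [<a><s>] is already a subgroup. Membership is phrased
    through an exponent [k], so that an exponent can later be chosen as a function of the
    element. *)
Lemma generated_cons (a : G) (s : seq G) :
  (forall x, x \in s -> commute a x) ->
  generated [set` a :: s] =
    [set x | exists k, generated [set` s] (zpow a (- k)%R * x)].
Proof.
move=> cas; have cC := sub_center_generated cas.
have sC := @generated_subgroup _ [set` s]; set C := generated [set` s] in cC sC *.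
apply/seteqP; split.
  apply: generated_sub => [|x /=].
    apply: subgroupP; first by exists 0%R; rewrite /= mul1g; apply: (subgroup1 sC).
    move=> x y [k kx] [l ly]; exists (k - l)%R.
    set X := zpow a _ * x in kx; set Y := zpow a _ * y in ly.
    have cXY : commute (zpow a l) (X * Y^-1).
      by apply/commute_sym/commute_zpow/commute_sym/cC; apply: (subgroupF sC).
    have -> : zpow a (- (k - l))%R * (x * y^-1) =
              zpow a l * (X * Y^-1) * (zpow a l)^-1.
      have -> : (- (k - l) = l - k)%R by lia.
      by rewrite /X /Y zpowD invgM !zpowN invgK !mulgA mulgK.
    by rewrite cXY mulgK; apply: (subgroupF sC).
  rewrite inE => /orP[/eqP -> | xs].
    by exists 1%R; rewrite /= mulVg; apply: (subgroup1 sC).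
  by exists 0%R; rewrite /= mul1g; apply: sub_generated.
move=> x [k hk].
have sA := @generated_subgroup _ [set` a :: s].
have hA : C `<=` generated [set` a :: s].
  apply: (generated_sub sA) => y ys; apply: sub_generated => /=.
  by rewrite inE; apply/orP; right.
apply: (subgroupMl sA _ (hA _ hk)); apply: (subgroup_zpow _ sA).
by apply: sub_generated => /=; rewrite inE eqxx.
Qed.

End Separation.

(** Induction on the generators, with [C] generated by [s]. Either a positive power of [a] lies in
    [C], and [C] has finite index; or [<a>] meets [C] trivially, the group is the direct product of
    the two, and the exponent of [a] is one more homomorphism to the integers. *)
Lemma int_separated_generated (G : groupType) (s : seq G) :
  (forall x y, x \in s -> y \in s -> commute x y) ->
  int_separated (generated [set` s]) [set 1].
Proof.
elim: s => [|a s IH] hs.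
  have sC := @generated_subgroup _ [set` ([::] : seq G)].
  exists (generated [set` [::]]), void, (fun _ _ => 0%R).
  split=> //; first exact: fin_idx_refl.
  move=> x + _; apply: generated_sub => //.
  by apply: subgroupP => // x0 y -> ->; rewrite /= mulgV.
have {}IH : int_separated (generated [set` s]) [set 1].
  by apply: IH => x y xs ys; apply: hs; rewrite inE ?xs ?ys orbT.
have cas x : x \in s -> commute a x.
  by move=> xs; apply: hs; rewrite inE ?eqxx ?xs ?orbT.
have cC := sub_center_generated cas.
have hA := generated_cons cas.
have sA := @generated_subgroup _ [set` a :: s].
have sC := @generated_subgroup _ [set` s].
move: hA sA; set A := generated [set` a :: s] => hA sA.
set C := generated [set` s] in IH cC sC hA.
have hCA : C `<=` A by move=> c hc; rewrite hA; exists 0%R; rewrite /= mul1g.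
have cCz c k : C c -> commute (zpow a k) c.
  by move=> hc; apply/commute_sym/commute_zpow/commute_sym/cC.
pose K x := xget 0%R [set k | C (zpow a (- k)%R * x)].
have hK x : A x -> C (zpow a (- K x)%R * x).
  rewrite hA => -[k hk]; rewrite /K; case: xgetP => [y _ //|/(_ k)].
  by case.
have split_x x : x = zpow a (K x) * (zpow a (- K x)%R * x).
  by rewrite mulgA -zpowD GRing.subrr mul1g.
have quot x y : A x -> A y -> x^-1 * y =
    zpow a (K y - K x)%R *
      ((zpow a (- K x)%R * x)^-1 * (zpow a (- K y)%R * y)).
  move=> ax ay; rewrite {1}(split_x x) {1}(split_x y).
  set X := zpow a (- K x)%R * x; set Y := zpow a (- K y)%R * y.
  have cX : commute (zpow a (K y - K x)%R) X^-1.
    by apply: cCz; apply: (subgroupV sC); apply: hK.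
  rewrite [RHS]mulgA cX invgM -!mulgA; congr (_ * _).
  by rewrite !mulgA -zpowN -zpowD GRing.addrC.
have [[m m0 hm]|hm] := pselect (exists2 m : nat, (0 < m)%N & C (a ^+ m)).
  have iCA : fin_idx C A.
    case: m m0 hm => // m _ hm.
    (* Exponents congruent modulo [m.+1] differ by a multiple of it, and the corresponding power of
       [a] lies in [C]. *)
    exists 'I_m.+1, (fun x => inord `|modz (K x) m.+1|%N) => x y ax ay.
    move=> /(congr1 val); rewrite /= !inordK; try lia.
    move=> e; rewrite quot //.
    apply: (subgroupM sC).
      have [j ->] : exists j : int, (K y - K x = m.+1%:Z * j)%R.
        exists (divz (K y) m.+1 - divz (K x) m.+1)%R; lia.
      by rewrite zpowM; apply: (subgroup_zpow _ sC).
    by apply: (subgroupM sC); [apply: (subgroupV sC)|]; apply: hK.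
  exact: int_separated_fin_idx IH.
have injK k : C (zpow a k) -> k = 0%R.
  case: k => n hn; last first.
    case: hm; exists n.+1 => //.
    by rewrite -[_ ^+ _]invgK; apply: (subgroupV sC).
  by case: n hn => // n hn; case: hm; exists n.+1.
have KE x k : A x -> C (zpow a (- k)%R * x) -> K x = k.
  move=> ax hk; apply/eqP; rewrite -GRing.subr_eq0; apply/eqP; apply: injK.
  have -> : zpow a (K x - k)%R = zpow a (- k)%R * x * (zpow a (- K x)%R * x)^-1.
    by rewrite invgM mulgA mulgK -zpowN GRing.opprK -zpowD GRing.addrC.
  by apply: (subgroupF sC) => //; apply: hK.
have KM x y : A x -> A y ->
    zpow a (- (K x + K y))%R * (x * y) =
    (zpow a (- K x)%R * x) * (zpow a (- K y)%R * y).
  move=> ax ay; rewrite GRing.opprD GRing.addrC zpowD.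
  transitivity (zpow a (- K y)%R * (zpow a (- K x)%R * x) * y).
    by rewrite !mulgA.
  by rewrite cCz ?mulgA //; apply: hK.
have KD x y : A x -> A y -> K (x * y) = (K x + K y)%R.
  move=> ax ay; apply: KE; first exact: (subgroupM sA).
  by rewrite KM //; apply: (subgroupM sC); apply: hK.
have K1 : K 1 = 0%R by apply: KE; rewrite ?mulg1; apply: (subgroup1 _).
have KV y : A y -> K y^-1 = (- K y)%R.
  move=> ay; have := KD _ _ ay (subgroupV sA ay); rewrite mulgV K1; lia.
have [B [I [f [sB hBC iB hf hQ]]]] := IH.
pose r x := zpow a (- K x)%R * x.
have rM x y : A x -> A y -> r (x * y) = r x * r y.
  by move=> ax ay; rewrite /r KD // KM.
have rV x : A x -> r x^-1 = (r x)^-1.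
  move=> ax; apply: (@mulgI _ (r x)).
  by rewrite -rM ?mulgV /r ?K1 ?mulg1 //; apply: (subgroupV sA).
exists (A `&` r @^-1` B), (option I),
  (fun i x => if i is Some i then f i (r x) else K x); split.
- apply: subgroupP.
    by split; rewrite /= ?/r ?K1 ?mulg1; apply: subgroup1.
  move=> x y [ax bx] [ay bY]; have aV := subgroupV sA ay; split.
    exact: (subgroupM sA).
  by rewrite /= rM // rV //; apply: (subgroupF sB).
- by move=> x [].
- apply: (fin_idx_preim _ sA hK iB) => x y ax ay.
  by rewrite -/(r _) rM ?rV //; apply: (subgroupV sA).
- case=> [i|] x y [ax bx] [ay bY]; last exact: KD.
  by rewrite rM // hf.
- move=> x [ax bx] h; have k0 : K x = 0%R := h None.
  have := hQ _ bx (fun i => h (Some i)).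
  by rewrite /= /r k0 mul1g.
Qed.

(** Schreier's argument on right cosets of [A]: the products of elements of [<U>] with
    representatives are stable under right multiplication by the generators of [H] and their
    inverses, hence fill [H]. An element of [A] so written has its representative in [A], hence in
    [U]. *)
Lemma schreier (G : groupType) (H A : set G) :
  finitely_generated H -> subgroup A -> A `<=` H -> fin_idx A H ->
  exists U : seq G, A = generated [set` U].
Proof.
move=> [S /finite_seqP[s ->] ->].
have sH := @generated_subgroup _ [set` s]; have hs := @sub_generated _ [set` s].
move: sH hs; set H0 := generated [set` s] => sH hs sA hAH [T [F hF]].
(* [F] separates left cosets; applied to inverses it separates right cosets. *)
pose rp t := xget 1 [set y | H0 y /\ F y^-1 = t].
(* All pairs of representatives are listed; filtering by [A] keeps in particular the Schreier
   generators, so no action on labels has to be defined. *)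
pose U0 := [seq rp t | t <- enum T] ++
  [seq rp v.1 * x * (rp v.2)^-1 | v <- enum {: T * T},
                                  x <- s ++ [seq x^-1 | x <- s]].
pose U := [seq u <- U0 | `[< A u >]].
exists U.
have sU := @generated_subgroup _ [set` U]; have hU := @sub_generated _ [set` U].
have UA : generated [set` U] `<=` A.
  by apply: (generated_sub sA) => u /=; rewrite mem_filter => /andP[/asboolP].
move: sU hU UA; set B := generated [set` U] => sU hU UA.
apply/seteqP; split=> //.
have hrp x : H0 x -> H0 (rp (F x^-1)) /\ A (x * (rp (F x^-1))^-1).
  move=> hx; rewrite /rp; case: xgetP => [y _ [hy e]|/(_ x)]; last by case.
  split=> //; have := hF _ _ (subgroupV sH hx) (subgroupV sH hy) (esym e).
  by rewrite invgK.
pose E y := exists b t, [/\ B b, H0 (rp t) & y = b * rp t].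
have E1 : E 1.
  have [h a] := hrp _ (subgroup1 sH).
  exists (rp (F 1^-1))^-1, (F 1^-1); split=> //; last by rewrite mulVg.
  apply: (subgroupV sU); apply: hU; rewrite /= mem_filter; apply/andP; split.
    apply/asboolP; rewrite -[rp _]invgK; apply: (subgroupV sA).
    by rewrite -[_^-1]mul1g.
  by rewrite mem_cat; apply/orP; left; apply: map_f; rewrite mem_enum.
have Es x y : x \in s ++ [seq x^-1 | x <- s] -> E y -> E (y * x).
  move=> xs [b [t [hb ht ->]]].
  have hx : H0 x.
    move: xs; rewrite mem_cat => /orP[/hs //|/mapP[z /hs hz ->]].
    exact: (subgroupV sH).
  have [h1 h2] := hrp _ (subgroupM sH ht hx).
  set t' := F _ in h1 h2.
  exists (b * (rp t * x * (rp t')^-1)), t'; split=> //.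
    apply: (subgroupM sU) => //; apply: hU; rewrite /= mem_filter.
    apply/andP; split; first exact/asboolP.
    rewrite mem_cat; apply/orP; right.
    by apply/allpairsP; exists ((t, t'), x); split; rewrite ?mem_enum.
  by rewrite !mulgA mulgVK.
have HE x : H0 x -> E x.
  move=> hx; rewrite -[x]mul1g.
  suff [h _] : (forall y, E y -> E (y * x)) /\ (forall y, E y -> E (y * x^-1)).
    exact: h.
  apply: (@generated_sub _ _
    [set x | (forall y, E y -> E (y * x)) /\ (forall y, E y -> E (y * x^-1))])
    hx.
    apply: subgroupP; first by split=> y; rewrite ?invg1 mulg1.
    move=> u v [u1 u2] [v1 v2]; split=> y ey; rewrite ?invgM ?invgK mulgA.
      by apply/v2/u1.
    by apply/u2/v1.
  move=> z zs; split=> y; apply: Es; rewrite mem_cat ?zs //.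
  by apply/orP; right; apply: map_f.
move=> x ax; have [b [t [hb ht e]]] := HE _ (hAH _ ax).
rewrite e; apply: (subgroupM sU) => //; apply: hU; rewrite /= mem_filter.
apply/andP; split.
  by apply/asboolP; apply: (subgroupMl sA (UA _ hb)); rewrite -e.
by rewrite mem_cat; apply/orP; left; apply: map_f; rewrite mem_enum.
Qed.

Lemma int_separated_fg_vab (G : groupType) (H : set G) :
  finitely_generated H -> virtually_abelian H -> int_separated H [set 1].
Proof.
move=> fgH [A [sA hAH /(fin_idxP _ sA) iA abA]].
have [U eU] := schreier fgH sA hAH iA.
apply: (int_separated_fin_idx hAH iA); rewrite eU.
apply: int_separated_generated => x y xU yU; apply: abA; apply: mem_set;
  by rewrite eU; apply: sub_generated.
Qed.

Lemma int_separated_vcyclic (G : groupType) (H : set G) :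
  virtually_cyclic H -> int_separated H [set 1].
Proof.
move=> [A [sA hAH /(fin_idxP _ sA) iA [c eA]]].
apply: (int_separated_fin_idx hAH iA); rewrite eA.
have -> : [set c] = [set` [:: c]].
  by apply/seteqP; split=> x /=; rewrite inE => /eqP.
by apply: int_separated_generated => x y; rewrite !inE => /eqP -> /eqP ->.
Qed.

(** Realises the quotient by [R] as a finite type with a section through a prescribed point. Equal
    labels imply related points but not conversely, so a class is encoded by the first label that it
    contains. *)
Lemma finite_classes (S : Type) (x0 : S) (R : S -> S -> Prop)
    (T : finType) (F : S -> T) :
  (forall x, R x x) -> (forall x y, R x y -> R y x) ->
  (forall x y z, R x y -> R y z -> R x z) ->
  (forall x y, F x = F y -> R x y) ->
  exists (C : finType) (cls : S -> C) (rep : C -> S),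
    [/\ forall x y, cls x = cls y <-> R x y, cancel rep cls
      & rep (cls x0) = x0].
Proof.
move=> Rr Rs Rt hF.
pose m x := [pick t | `[< exists y, F y = t /\ R x y >]].
have mE x y : m x = m y <-> R x y.
  split.
    rewrite /m; case: pickP => [t /asboolP[u [ut xu]]|/(_ (F x))]; last first.
      by move=> /asboolP[]; exists x.
    case: pickP => // t' /asboolP[v [vt yv]] [e].
    apply: Rt xu (Rt _ _ _ _ (Rs _ _ yv)); apply: hF.
    by rewrite ut vt e.
  move=> xy; apply: eq_pick => t; apply/asbool_equiv_eq; split.
    by move=> [u [ut xu]]; exists u; split=> //; apply: Rt (Rs _ _ xy) xu.
  by move=> [u [ut xu]]; exists u; split=> //; apply: Rt xy xu.
pose C := {o : option T | `[< exists x, m x = o >]}.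
have mC x : `[< exists y, m y = m x >] by apply/asboolP; exists x.
pose cls x : C := exist _ (m x) (mC x).
have clsE x y : cls x = cls y <-> R x y.
  rewrite -mE; split; first by move=> /(congr1 val).
  by move=> e; apply: val_inj.
have repP (c : C) : exists x, cls x = c /\ (c = cls x0 -> x = x0).
  have [->|hc] := pselect (c = cls x0); first by exists x0.
  case: c hc => o ho hc; have /asboolP[x hx] := ho.
  by exists x; split; [apply: val_inj | move=> /hc].
have [rep hrep] := choice repP.
exists C, cls, rep; split=> //; first by move=> c; have [] := hrep c.
by have [_] := hrep (cls x0); apply.
Qed.

(** * Virtually abelian quotients *)

(* The wreath product [Z wr Sym X], its elements acting on the right. *)
Definition wreath (X : finType) : Type := ({perm X} * {ffun X -> int})%type.

Section Wreath.
Variable X : finType.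
Local Notation W := (wreath X).

HB.instance Definition _ := Choice.on W.

Definition wreath_mul (u v : W) : W :=
  (u.1 * v.1, [ffun x => (u.2 x + v.2 (u.1 x))%R]).

Definition wreath_one : W := (1, [ffun=> 0%R]).

Definition wreath_inv (u : W) : W :=
  (u.1^-1, [ffun x => (- u.2 ((u.1^-1)%g x))%R]).

Lemma wreathP (u v : W) : u.1 = v.1 -> u.2 =1 v.2 -> u = v.
Proof. by case: u v => [s f] [s' f'] /= -> /ffunP ->. Qed.

Fact wreath_mulA : associative wreath_mul.
Proof.
move=> u v w; apply: wreathP; first exact: mulgA.
by move=> x; rewrite !ffunE /= permM GRing.addrA.
Qed.

Fact wreath_mul1g : left_id wreath_one wreath_mul.
Proof.
move=> u; apply: wreathP; first exact: mul1g.
by move=> x; rewrite !ffunE /= perm1 GRing.add0r.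
Qed.

Fact wreath_mulg1 : right_id wreath_one wreath_mul.
Proof.
move=> u; apply: wreathP; first exact: mulg1.
by move=> x; rewrite !ffunE /= GRing.addr0.
Qed.

Fact wreath_mulVg : left_inverse wreath_one wreath_inv wreath_mul.
Proof.
move=> u; apply: wreathP; first exact: mulVg.
by move=> x; rewrite !ffunE /= GRing.addNr.
Qed.

Fact wreath_mulgV : right_inverse wreath_one wreath_inv wreath_mul.
Proof.
move=> u; apply: wreathP; first exact: mulgV.
by move=> x; rewrite !ffunE /= -permM mulgV perm1 GRing.subrr.
Qed.

HB.instance Definition _ := isGroup.Build W wreath_mulA
  wreath_mul1g wreath_mulg1 wreath_mulVg wreath_mulgV.

Definition translations : set W := [set u | u.1 = 1].

Lemma translations_subgroup : subgroup translations.
Proof.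
apply: subgroupP => // u v eu ev; rewrite /translations /= in eu ev *.
by rewrite eu ev mulgV.
Qed.

Lemma wreath_vab : virtually_abelian [set: W].
Proof.
exists translations; split=> //; first exact: translations_subgroup.
  apply/fin_idxP; first exact: translations_subgroup.
  exists {perm X}, fst => u v _ _ e; rewrite /translations /= e.
  by rewrite mulVg.
move=> u v /set_mem eu /set_mem ev; rewrite /translations /= in eu ev.
apply: wreathP; rewrite /= ?eu ?ev // => x.
by rewrite !ffunE !perm1 GRing.addrC.
Qed.

Lemma wreath_fg : finitely_generated [set: W].
Proof.
pose d x : W := (1, [ffun y => (y == x)%:R%R]).
pose p (s : {perm X}) : W := (s, [ffun=> 0%R]).
exists ([set d x | x in [set: X]] `|` [set p s | s in [set: {perm X}]]).
  by rewrite finite_setU; split; apply: finite_image; apply: finite_finset.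
apply/seteqP; split=> // u _.
set S := _ `|` _.
have sS := @generated_subgroup _ S; have hS := @sub_generated _ S.
pose t (f : X -> int) : W := (1, [ffun x => f x]).
have tD f g : t (fun x => f x + g x)%R = t f * t g.
  apply: wreathP; rewrite /= ?mulg1 // => x.
  by rewrite !ffunE /= perm1.
have tX f n : t (fun x => f x * n)%R = zpow (t f) n.
  pose h n := t (fun x => f x * n)%R.
  have h0 : h 0%R = 1.
    by apply: wreathP => // x; rewrite !ffunE GRing.mulr0.
  have hX (k : nat) : h k = t f ^+ k.
    elim: k => [|k IH]; first exact: h0.
    rewrite expgS -IH -tD; apply: wreathP => // x; rewrite !ffunE; lia.
  case: n => k; first exact: hX.
  apply: (@mulgI _ (t f ^+ k.+1)); rewrite mulgV -hX -h0 -tD.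
  by apply: wreathP => // x; rewrite !ffunE; lia.
have td x : t (fun y => (y == x)%:R%R) = d x by [].
have tS (f : X -> int) : generated S (t f).
  (* Expansion in indicator functions: induction along the enumeration of [X] then builds the
     translation from powers of unit ones. *)
  have -> : t f = t (fun y => \sum_(x <- enum X) (y == x)%:R * f x)%R.
    apply: wreathP => // y; rewrite !ffunE big_enum /= (bigD1 y) //= eqxx.
    rewrite GRing.mul1r big1 ?GRing.addr0 // => x /negPf yx.
    by rewrite eq_sym yx GRing.mul0r.
  elim: (enum X) => [|x s IH].
    suff -> : t (fun y => \sum_(x <- [::]) (y == x)%:R * f x)%R = 1.
      exact: (subgroup1 sS).
    by apply: wreathP => // y; rewrite !ffunE big_nil.
  have -> : t (fun y => \sum_(z <- x :: s) (y == z)%:R * f z)%R =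
     t (fun y => (y == x)%:R * f x)%R *
     t (fun y => \sum_(z <- s) (y == z)%:R * f z)%R.
    by rewrite -tD; apply: wreathP => // y; rewrite !ffunE big_cons.
  apply: (subgroupM sS) => //; rewrite (tX (fun y => (y == x)%:R%R)) td.
  by apply: (subgroup_zpow _ sS); apply: hS; left; exists x.
have -> : u = t u.2 * p u.1.
  apply: wreathP; rewrite /= ?mul1g // => x.
  by rewrite !ffunE GRing.addr0.
by apply: (subgroupM sS) => //; apply: hS; right; exists u.1.
Qed.

(** A right action [a] with a cocycle [k] amounts to the action [(x, n) |-> (a x g, n + k x g)] on
    copies of the integers indexed by [X]. *)
Lemma wreath_hom (G : groupType) (a : X -> G -> X) (k : X -> G -> int) :
  (forall x, a x 1 = x) -> (forall x g h, a x (g * h) = a (a x g) h) ->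
  (forall x g h, k x (g * h) = (k x g + k (a x g) h)%R) ->
  exists phi : {multiplicative G -> W},
    forall g x, (phi g).1 x = a x g /\ (phi g).2 x = k x g.
Proof.
move=> a1 aM kM.
have inj_a g : injective (a^~ g).
  by apply: (can_inj (g := a^~ g^-1)) => x; rewrite -aM mulgV a1.
pose phi g : W := (perm (inj_a g), [ffun x => k x g]).
have phiM : {morph phi : g h / g * h}.
  move=> g h; apply: wreathP => [|x].
    by apply/permP => x; rewrite permM !permE aM.
  by rewrite !ffunE /= permE kM.
pose m := isMultiplicative.Build G W phi phiM.
pose psi : {multiplicative G -> W} := HB.pack phi m.
by exists psi => g x; rewrite /= permE ffunE.
Qed.

End Wreath.

(** * Bounds on kernels of maps to finitely generated virtually abelian groups *)

Definition vab_kernel (G : groupType) (K : set G) : Prop :=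
  exists (P : groupType) (psi : {multiplicative G -> P}),
    [/\ finitely_generated [set: P], virtually_abelian [set: P]
      & ker psi `<=` K].

Lemma prod_fg (P Q : groupType) :
  finitely_generated [set: P] -> finitely_generated [set: Q] ->
  finitely_generated [set: (P * Q)%type].
Proof.
move=> [S fS eS] [T fT eT].
pose l (x : P) : P * Q := (x, 1); pose r (y : Q) : P * Q := (1, y).
exists ([set l x | x in S] `|` [set r y | y in T]).
  by rewrite finite_setU; split; apply: finite_image.
apply/seteqP; split=> // -[x y] _; set U := _ `|` _.
have sU := @generated_subgroup _ U; have hU := @sub_generated _ U.
have hl : generated U (l x).
  have : [set: P] x by [].
  rewrite eS; apply: (@generated_sub _ _ (l @^-1` generated U)).
    apply: subgroupP; first exact: (subgroup1 sU).
    move=> u v lu lv; have := subgroupF sU lu lv.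
    by rewrite /= (_ : l u * (l v)^-1 = l (u * v^-1)) //; congr pair; apply: mulgV.
  by move=> u Su; apply: hU; left; exists u.
have hr : generated U (r y).
  have : [set: Q] y by [].
  rewrite eT; apply: (@generated_sub _ _ (r @^-1` generated U)).
    apply: subgroupP; first exact: (subgroup1 sU).
    move=> u v lu lv; have := subgroupF sU lu lv.
    by rewrite /= (_ : r u * (r v)^-1 = r (u * v^-1)) //; congr pair; apply: mulgV.
  by move=> u Su; apply: hU; right; exists u.
have -> : (x, y) = l x * r y by congr pair; rewrite ?mulg1 ?mul1g.
exact: (subgroupM sU).
Qed.

Lemma prod_vab (P Q : groupType) :
  virtually_abelian [set: P] -> virtually_abelian [set: Q] ->
  virtually_abelian [set: (P * Q)%type].
Proof.
move=> [A [sA _ /(fin_idxP _ sA)[T [F hF]] abA]].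
move=> [B [sB _ /(fin_idxP _ sB)[U [E hE]] abB]].
have sAB : subgroup [set u : P * Q | A u.1 /\ B u.2].
  apply: subgroupP; first by split; apply: subgroup1.
  by move=> u v [au bu] [av bv]; split; apply: subgroupF.
exists [set u : P * Q | A u.1 /\ B u.2]; split=> //.
  apply/fin_idxP => //; exists (T * U)%type, (fun u => (F u.1, E u.2)).
  by move=> u v _ _ [e1 e2]; split; [apply: hF | apply: hE].
move=> u v /set_mem[au bu] /set_mem[av bv].
by congr pair; [apply: abA | apply: abB]; apply: mem_set.
Qed.

(** The product of the two maps serves. Each requirement of the theorem can thus be met by its own
    homomorphism. *)
Lemma vab_kernelI (G : groupType) (K L : set G) :
  vab_kernel K -> vab_kernel L -> vab_kernel (K `&` L).
Proof.
move=> [P [f [fP vP hK]]] [Q [g [fQ vQ hL]]].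
pose h x : (P * Q)%type := (f x, g x).
have hM : {morph h : x y / x * y}.
  by move=> x y; rewrite /h !gmulfM.
pose m := isMultiplicative.Build G (P * Q)%type h hM.
pose psi : {multiplicative G -> (P * Q)%type} := HB.pack h m.
exists (P * Q)%type, psi; split; [exact: prod_fg | exact: prod_vab|].
by move=> x [fx gx]; split; [apply: hK | apply: hL].
Qed.

Lemma vab_kernel_sub (G : groupType) (K L : set G) :
  K `<=` L -> vab_kernel K -> vab_kernel L.
Proof.
by move=> hKL [P [f [fP vP hK]]]; exists P, f; split=> // x /hK /hKL.
Qed.

Lemma int_separated_sub (G : groupType) (H Q Q' : set G) :
  (forall x, H x -> Q x -> Q' x) -> int_separated H Q -> int_separated H Q'.
Proof.
move=> h [B [I [f [sB hBH iB hf hQ]]]]; exists B, I, f; split=> // x bx fx.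
by apply: h (hBH _ bx) (hQ _ bx fx).
Qed.

(** The homomorphisms are pulled back along the retraction to a finite-index subgroup of [G]. As the
    retraction fixes [H] pointwise, they still detect the non-trivial elements of [H] on which they
    are defined. *)
Lemma int_separated_retract (G : groupType) (H : set G) :
  virtual_retract H -> int_separated H [set 1] ->
  int_separated [set: G] [set x | H x -> x = 1].
Proof.
move=> [K [sK hHK /(fin_idxP _ sK) iK [rho [rhoH rhoM rhoI]]]] sepH.
apply: (int_separated_fin_idx (subsetT K) iK).
have rhoM' x y : K x -> K y -> rho (x * y) = rho x * rho y.
  by move=> kx ky; apply: rhoM; apply: mem_set.
have rhoH' x : K x -> H (rho x) by move=> kx; apply: set_mem; apply/rhoH/mem_set.
apply: int_separated_sub (int_separated_preim sK rhoM' rhoH' sepH) => x _ /= e hx.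
by rewrite -e rhoI //; apply: mem_set.
Qed.

Lemma int_separated_range (G0 G : groupType) (j : {multiplicative G0 -> G}) :
  injective j -> int_separated [set: G0] [set 1] ->
  int_separated (range j) [set 1].
Proof.
move=> inj sep; pose r y := xget 1 [set x | j x = y].
have rK y : range j y -> j (r y) = y.
  by move=> [x _ e]; rewrite /r; case: xgetP => [? _ //|/(_ x)].
have sR : subgroup (range j).
  apply: subgroupP; first by exists 1; rewrite ?gmorph1.
  by move=> _ _ [x _ <-] [y _ <-]; exists (x * y^-1); rewrite ?gmorphF.
have rM x y : range j x -> range j y -> r (x * y) = r x * r y.
  move=> hx hy; apply: inj; rewrite gmulfM !rK //.
  exact: (subgroupM sR).
have rT x : range j x -> [set: G0] (r x) by [].
apply: int_separated_sub (int_separated_preim sR rM rT sep) => x hx /= e.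
by rewrite -(rK _ hx) e gmorph1.
Qed.

(** * Cyclic intersections with the amalgamated subgroup *)

Lemma fin_idx_power (G : groupType) (A : set G) (x : G) :
  fin_idx A [set: G] -> exists2 n : nat, (0 < n)%N & A (x ^+ n).
Proof.
move=> [T [F hF]].
have /injectivePn[i [k ik e]] :
    ~~ injectiveb (fun i : 'I_#|T|.+1 => F (x ^+ i)).
  by apply/injectiveP => /leq_card; rewrite card_ord ltnn.
wlog ltik : i k ik e / i < k.
  move=> h; case: (ltngtP i k) => [lt|lt|/val_inj eik].
  - exact: h ik e lt.
  - by apply: h lt; rewrite 1?eq_sym.
  - by rewrite eik eqxx in ik.
exists (k - i); first by rewrite subn_gt0.
have /hF - /(_ I I) := e; congr A.
by rewrite -(subnKC (ltnW ltik)) expgnDr mulKg addKn.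
Qed.

Lemma zpow1n (G : groupType) k : zpow (1 : G) k = 1.
Proof. by case: k => n; rewrite /zpow expg1n ?invg1. Qed.

(* Imposing that all conjugates of [x] have [f]-values divisible by the gcd [e]
   of the values on the conjugates of [w] cuts the intersection with [G0] down
   to exactly the cyclic group generated by [w]. *)
Lemma cyclic_intersection (G0 G : groupType) (j : {multiplicative G0 -> G})
    (B : set G) (I : finType) (f : I -> G -> int) (w : G0) :
  subgroup B -> (forall x g, B x -> B (x ^ g)) -> fin_idx B [set: G] ->
  (forall i, zhom B (f i)) -> B (j w) ->
  (forall g, exists s t, (0 < s)%N /\ g ^+ s = zpow w t) ->
  (forall g, B (j g) -> (forall i, f i (j g) = 0%R) -> g = 1) ->
  exists B' : set G, [/\ subgroup B', forall x g, B' x -> B' (x ^ g),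
    fin_idx B' [set: G], B' `<=` B &
    forall g, B' (j g) <-> range (zpow w) g].
Proof.
move=> sB nB iB hf bw hw hinj.
(* For [w = 1] every element of [G0] has finite order, so each [f i] vanishes on the part of [G0]
   inside [B], and [B] itself will do. *)
have [w1|w1] := pselect (w = 1).
  exists B; split=> // g; split=> [bg|[k _ <-]]; last first.
    by rewrite w1 zpow1n gmorph1; apply: subgroup1.
  exists 0%R => //; apply/esym/hinj => // i; have [s [t [s0]]] := hw g.
  rewrite w1 zpow1n => e; have : f i (j g ^+ s) = 0%R.
    by rewrite -gmorphX e gmorph1 (zhom1 sB (hf i)).
  rewrite (zhomX sB (hf i) s) // => h; apply/eqP; move/eqP: h.
  by rewrite GRing.mulf_eq0 => /orP[] //; lia.
have [i0 fi0] : exists i, f i (j w) <> 0%R.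
  by apply: contrapT => /forallNP h; apply: w1; apply: hinj => // i;
    apply: contrapT; apply: h.
(* The gcd of a possibly infinite family is obtained as its largest common divisor, bounded by the
   non-zero value at [i0]. *)
pose P (e : nat) := `[< forall i x, (e %| f i (j w ^ x))%Z >].
have P1 : exists e, P e by exists 1%N; apply/asboolP => i x; apply: dvd1z.
have Pmax e : P e -> (e <= `|f i0 (j w)|)%N.
  move=> /asboolP/(_ i0 1); rewrite conjg1 /= => h.
  by apply: dvdn_leq => //; rewrite ?absz_gt0; apply/eqP.
have [e /asboolP Pe emax] := ex_maxnP P1 Pmax.
have e0 : (0 < e)%N by apply: emax; apply/asboolP => i x; apply: dvd1z.
pose B1 := B `&` [set x | forall i, (e %| f i x)%Z].
have sB1 : subgroup B1.
  apply: subgroupP.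
    by split=> [|i]; [apply: subgroup1 | rewrite (zhom1 sB (hf i)) ?dvdz0].
  move=> x y [bx ex] [bY ey]; have bV := subgroupV sB bY; split=> [|i].
    exact: (subgroupM sB).
  by rewrite hf // (zhomV sB (hf i)) // GRing.rpredB.
have iB1 : fin_idx B1 [set: G].
  apply: (@fin_idx_trans _ _ B) => //.
  exists {ffun I -> 'I_e},
    (fun x => [ffun i => insubd (Ordinal e0) `|(f i x %% e)%Z|%N]).
  move=> x y bx bY exy; have bV := subgroupV sB bx; split=> [|i].
    exact: (subgroupM sB).
  rewrite hf // (zhomV sB (hf i)) //; move/ffunP/(_ i): exy; rewrite !ffunE.
  move/(congr1 val); rewrite !val_insubd.
  have lt z : (`|(f i z %% e)%Z| < e)%N by lia.
  rewrite !lt => h; rewrite GRing.addrC; have : (f i y %% e = f i x %% e)%Z by lia.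
  by move=> /eqP; rewrite eqz_mod_dvd.
(* Passing to the core imposes divisibility by [e] on all conjugates and restores normality. *)
exists (core B1); split.
- exact: core_subgroup.
- by move=> x g; apply: core_conj.
- exact: core_fin_idx.
- by move=> x /core_sub[].
move=> g; split=> [hg|[k _ <-] x]; last first.
  rewrite gmorph_zpow conj_zpow; have bx := nB _ x bw; split=> [|i].
    exact: (subgroup_zpow _ sB).
  by rewrite (zhom_zpow sB (hf i) k) // dvdz_mulr.
have bg : B (j g) by case/core_sub: hg.
have [s [t [s0 est]]] := hw g.
have fst i x : (f i (j g ^ x)%g * s = f i (j w ^ x)%g * t)%R.
  have := zhomX sB (hf i) s (nB _ x bg); have := zhom_zpow sB (hf i) t (nB _ x bw).
  by rewrite -conjXg -conj_zpow -gmorphX est gmorph_zpow => -> ->.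
have [s' [t' [s'0 cop fst']]] : exists (s' : nat) (t' : int),
    [/\ (0 < s')%N, coprimez s' t' &
     forall i x, (f i (j g ^ x)%g * s' = f i (j w ^ x)%g * t')%R].
  have [s1 es] := dvdzP (dvdz_gcdl s t); have [t1 et] := dvdzP (dvdz_gcdr s t).
  have [u [v Duv]] := Bezoutz s t.
  have : (0 <= gcdz s t)%R by []; move: (gcdz s t) es et Duv => d es et Duv d0.
  have s1_gt0 : (0 < s1)%R by nia.
  exists `|s1|%N, t1; split=> [||i x]; first by rewrite absz_gt0; lia.
    by rewrite gtz0_abs //; apply/coprimezP; exists (u, v) => /=; nia.
  by have := fst i x; rewrite gtz0_abs // es et; nia.
(* Being prime to [t'], the number [s'] divides every quotient of [f i (j w ^ x)] by [e]; so
   [e * s'] is a common divisor and maximality of [e] forces [s' = 1]. Then [g] and [zpow w t'] have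
   the same values, hence coincide. *)
have s'1 : s' = 1%N.
  suff : (e * s' <= e)%N by nia.
  apply: emax; apply/asboolP => i x.
  have [v ev] := dvdzP (Pe i x); have [_ /(_ i)] := hg x.
  move=> /dvdzP[y ey]; have := fst' i x; rewrite ev ey => h.
  have : (s' %| v)%Z.
    rewrite -(Gauss_dvdzl v cop); apply/dvdzP; exists y; nia.
  by move=> /dvdzP[u ->]; apply/dvdzP; exists u; lia.
exists t' => //; apply/esym/divg1_eq/hinj.
  by rewrite gmorphF gmorph_zpow; apply: (subgroupF sB) => //; apply: subgroup_zpow.
move=> i; have bwt : B (j (zpow w t')) by rewrite gmorph_zpow; apply: subgroup_zpow.
rewrite gmorphF hf ?(zhomV sB (hf i)) //; last exact: (subgroupV sB).
have := fst' i 1; rewrite !conjg1 s'1 gmorph_zpow (zhom_zpow sB (hf i) t') //; lia.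
Qed.

(** * Induced representations of an amalgam *)

(* The space of cosets of [B] in [G], presented as [Gam * T] where [Gam] is
   the space of cosets of [B] met with [G0] and [T] that of the double cosets
   of [B] and [G0]: here [q] maps an element to its coset, and [e] picks
   representatives on which [G0] acts through the first factor only. *)
Lemma coset_product (G0 G : groupType) (j : {multiplicative G0 -> G})
    (B : set G) (Gam : finType) (cls : G0 -> Gam) (rep : Gam -> G0) :
  subgroup B -> (forall x g, B x -> B (x ^ g)) -> fin_idx B [set: G] ->
  (forall g h, cls g = cls h <-> B (j (g * h^-1))) ->
  cancel rep cls -> rep (cls 1) = 1 ->
  exists (T : finType) (q : G -> Gam * T) (e : Gam * T -> G) (t0 : T),
    [/\ forall x y, q x = q y <-> B (x * y^-1),
        cancel e q /\ e (cls 1, t0) = 1,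
        forall c t, e (c, t) = e (cls 1, t) * j (rep c)
      & forall c t g, q (e (c, t) * j g) = (cls (rep c * g), t)].
Proof.
move=> sB nB [U [F hF]] clsE repK rep1.
pose R x y := exists b g, B b /\ y = b * x * j g.
have Rs x y : R x y -> R y x.
  move=> [b [g [bb ->]]]; exists b^-1, g^-1; split; first exact: (subgroupV sB).
  by rewrite gmorphV !mulgA mulVg mul1g mulgK.
have Rt x y z : R x y -> R y z -> R x z.
  move=> [b [g [bb ->]]] [c [h [bc ->]]]; exists (c * b), (g * h).
  by split; [apply: (subgroupM sB) | rewrite gmulfM !mulgA].
have Rr x : R x x.
  by exists 1, 1; rewrite gmorph1 mul1g mulg1; split=> //; apply: (subgroup1 sB).
have RB x y : B (x * y^-1) -> R x y.
  move=> h; exists (y * x^-1), 1; rewrite gmorph1 mulg1 mulgVK; split=> //.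
  by have := subgroupV sB h; rewrite invgM invgK.
have FR x y : F x^-1 = F y^-1 -> R x y.
  by move=> h; apply: RB; have := hF _ _ I I h; rewrite invgK.
have [T [cl [tr [clE trK tr1]]]] :=
  @finite_classes _ 1 R _ (fun x => F x^-1) Rr Rs Rt FR.
pose e (p : Gam * T) := tr p.2 * j (rep p.1).
have ex x : exists c, B (x * (e (c, cl x))^-1).
  have [b [g [bb ex]]] : R (tr (cl x)) x by apply/clE; rewrite trK.
  exists (cls g); rewrite {1}ex invgM -gmorphV !mulgA -(mulgA _ (j g)) -gmulfM.
  have h : B (j (g * (rep (cls g))^-1)) by apply/clsE; rewrite repK.
  rewrite -!mulgA; apply: (subgroupM sB) => //.
  by have := nB _ (tr (cl x))^-1 h; rewrite /conjg invgK.
have [c hc] := choice ex.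
pose q x := (c x, cl x).
(* Each right coset of [B] contains exactly one [e p], so the choice made in [q] is forced.
   Normality of [B] cancels the conjugation by [tr t]. *)
have qE x p : B (x * (e p)^-1) -> q x = p.
  case: p => d t h.
  have et : cl x = t.
    rewrite -(trK t); apply/clE; apply: Rt (RB _ _ h) _.
    by apply: Rs; exists 1, (rep d); rewrite mul1g; split=> //; apply: (subgroup1 sB).
  congr pair => //; rewrite -(repK (c x)) -(repK d); apply/clsE.
  have := hc x; rewrite et => hx; have := subgroupM sB (subgroupV sB hx) h.
  have -> : (x * (e (c x, t))^-1)^-1 * (x * (e (d, t))^-1) =
            (j (rep (c x) * (rep d)^-1)) ^ (tr t)^-1.
    by rewrite /conjg gmorphF /e /= !invgM !invgK !mulgA mulgVK.
  by move=> /(nB _ (tr t)); rewrite -conjgM mulVg conjg1.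
exists T, q, e, (cl 1); split.
- move=> x y; split=> [exy|h].
    have := subgroupM sB (hc x) (subgroupV sB (hc y)).
    rewrite -[(c x, _)]/(q x) -[(c y, _)]/(q y) exy.
    by rewrite (invgM y) invgK mulgA mulgVK.
  apply: qE; have := subgroupM sB h (hc y).
  by rewrite !mulgA mulgVK.
- split; last by rewrite /e /= tr1 rep1 gmorph1 mulg1.
  by move=> p; apply: qE; rewrite mulgV; apply: (subgroup1 sB).
- by move=> d t; rewrite /e /= rep1 gmorph1 mulg1.
- move=> d t g; apply: qE; rewrite /e /= invgM -gmorphV !mulgA.
  rewrite -(mulgA (tr t)) -gmulfM -(mulgA (tr t)) -gmulfM.
  have h : B (j (rep d * g * (rep (cls (rep d * g)))^-1)).
    by apply/clsE; rewrite repK.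
  by have := nB _ (tr t)^-1 h; rewrite /conjg invgK mulgA.
Qed.

(** The induced representation in monomial form: [e x * g] is an element of [B] times the
    representative [e (a x g)], and [k] is the value of [f] on that element. Along a product these
    elements of [B] multiply. *)
Lemma induced_cocycle (G : groupType) (B : set G) (Q : Type) (q : G -> Q)
    (e : Q -> G) (f : G -> int) :
  subgroup B -> zhom B f ->
  (forall x y, q x = q y <-> B (x * y^-1)) -> cancel e q ->
  let a x g := q (e x * g) in
  let k x g := f (e x * g * (e (a x g))^-1) in
  [/\ forall x, a x 1 = x, forall x g h, a x (g * h) = a (a x g) h &
      forall x g h, k x (g * h) = (k x g + k (a x g) h)%R].
Proof.
move=> sB hf qE eK a k.
have ak x g : B (e x * g * (e (a x g))^-1) by apply/qE; rewrite eK.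
have aM x g h : a x (g * h) = a (a x g) h.
  by apply/qE; rewrite invgM !mulgA mulgK.
split=> // [x|x g h]; first by rewrite /a mulg1.
by rewrite /k -hf // aM; congr f; rewrite !mulgA mulgVK.
Qed.

(** The weights [c1] and [c2] balance the two actions: an element of [G0] lying in both subgroups
    translates each copy of the integers equally, so the universal property glues the actions. Only
    elements coming from [G1] are controlled; exchanging the factors handles [G2]. *)
Lemma amalgam_vab_kernel (G0 G1 G2 G : groupType)
    (j1 : {multiplicative G0 -> G1}) (j2 : {multiplicative G0 -> G2})
    (i1 : {multiplicative G1 -> G}) (i2 : {multiplicative G2 -> G})
    (B1 : set G1) (B2 : set G2) (f1 : G1 -> int) (f2 : G2 -> int)
    (c1 : G1 -> int) (c2 : G2 -> int) :
  is_amalgam j1 j2 i1 i2 ->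
  subgroup B1 -> (forall x g, B1 x -> B1 (x ^ g)) -> fin_idx B1 [set: G1] ->
  subgroup B2 -> (forall x g, B2 x -> B2 (x ^ g)) -> fin_idx B2 [set: G2] ->
  (forall g, B1 (j1 g) <-> B2 (j2 g)) -> zhom B1 f1 -> zhom B2 f2 ->
  (forall d x1 x2, B1 (j1 d) ->
    f1 (j1 d ^ x1)%g * c2 x2 = f2 (j2 d ^ x2)%g * c1 x1)%R ->
  c2 1 <> 0%R ->
  vab_kernel [set x | forall y, x = i1 y -> B1 y /\ f1 y = 0%R].
Proof.
move=> [ij univ] sB1 nB1 iB1 sB2 nB2 iB2 eB hf1 hf2 hc c2n0.
pose D := j1 @^-1` B1.
have sD : subgroup D.
  apply: subgroupP => [|x y dx dy]; first by rewrite /D /= gmorph1; apply: subgroup1.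
  by rewrite /D /= gmorphF; apply: subgroupF.
have [U [F hF]] := iB1.
have [Gam [cls [rep [clsE repK rep1]]]] :
    exists (Gam : finType) (cls : G0 -> Gam) (rep : Gam -> G0),
    [/\ forall x y, cls x = cls y <-> D (x * y^-1), cancel rep cls
      & rep (cls 1) = 1].
  apply: (@finite_classes _ 1 _ U (fun x => F (j1 x^-1))).
  - by move=> x; rewrite mulgV; apply: (subgroup1 sD).
  - by move=> x y /(subgroupV sD); rewrite invgM invgK.
  - by move=> x y z h h'; have := subgroupM sD h h'; rewrite mulgA mulgVK.
  - by move=> x y /hF - /(_ I I); rewrite gmorphV invgK -gmulfM.
have [T1 [q1 [e1 [t1 [q1E [e1K e11] e1j q1j]]]]] :=
  coset_product sB1 nB1 iB1 clsE repK rep1.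
(* As both subgroups meet [G0] in [D], one index set [Gam] with one choice of representatives serves
   both factors. *)
have clsE2 x y : cls x = cls y <-> B2 (j2 (x * y^-1)) by rewrite clsE -eB.
have [T2 [q2 [e2 [t2 [q2E [e2K e21] e2j q2j]]]]] :=
  coset_product sB2 nB2 iB2 clsE2 repK rep1.
have [a1_1 a1M k1M] := induced_cocycle sB1 hf1 q1E e1K.
have [a2_1 a2M k2M] := induced_cocycle sB2 hf2 q2E e2K.
pose X : finType := (Gam * T1 * T2)%type.
pose g0 := cls 1.
pose a1 (x : X) g : X := (q1 (e1 x.1 * g), x.2).
(* The weight depends only on the last coordinate, which [a1] fixes, so the cocycle identity
   survives the scaling. *)
pose k1 (x : X) g :=
  (f1 (e1 x.1 * g * (e1 (q1 (e1 x.1 * g)))^-1)%g * c2 ((e2 (g0, x.2))^-1)%g)%R.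
pose p2 (x : X) := (x.1.1, x.2).
pose a2 (x : X) g : X :=
  let u := q2 (e2 (p2 x) * g) in (u.1, x.1.2, u.2).
pose k2 (x : X) g :=
  (f2 (e2 (p2 x) * g * (e2 (q2 (e2 (p2 x) * g)))^-1)%g *
     c1 ((e1 (g0, x.1.2))^-1)%g)%R.
have [phi1 h1] : exists phi : {multiplicative G1 -> wreath X},
    forall g x, (phi g).1 x = a1 x g /\ (phi g).2 x = k1 x g.
  apply: wreath_hom => [[p t]|[p t] g h|[p t] g h].
  - by rewrite /a1 /= a1_1.
  - by rewrite /a1 /= a1M.
  - by rewrite /k1 /= k1M GRing.mulrDl.
have [phi2 h2] : exists phi : {multiplicative G2 -> wreath X},
    forall g x, (phi g).1 x = a2 x g /\ (phi g).2 x = k2 x g.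
  apply: wreath_hom => [[[c u] t]|[[c u] t] g h|[[c u] t] g h].
  - by rewrite /a2 /p2 /= a2_1.
  - by rewrite /a2 /p2 /= a2M -surjective_pairing.
  - by rewrite /k2 /a2 /p2 /= k2M -surjective_pairing GRing.mulrDl.
have agree : phi1 \o j1 =1 phi2 \o j2.
  move=> g; apply: wreathP => [|[[c u] t]] /=.
    apply/permP => -[[c u] t]; have [-> _] := h1 (j1 g) (c, u, t).
    have [-> _] := h2 (j2 g) (c, u, t).
    by rewrite /a1 /a2 /p2 /= q1j q2j.
  have [_ ->] := h1 (j1 g) (c, u, t); have [_ ->] := h2 (j2 g) (c, u, t).
  rewrite /k1 /k2 /p2 /= q1j q2j.
  (* The same [d] arises on both sides, conjugated by the inverse of a double coset representative;
     hence the inverses in the weights. *)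
  set c' := cls _; pose d := rep c * g * (rep c')^-1.
  have Dd : B1 (j1 d) by apply/clsE; rewrite repK.
  have -> : e1 (c, u) * j1 g * (e1 (c', u))^-1 = j1 d ^ (e1 (g0, u))^-1.
    by rewrite (e1j c) (e1j c') /d /conjg !gmulfM gmorphV invgM invgK !mulgA.
  have -> : e2 (c, t) * j2 g * (e2 (c', t))^-1 = j2 d ^ (e2 (g0, t))^-1.
    by rewrite (e2j c) (e2j c') /d /conjg !gmulfM gmorphV invgM invgK !mulgA.
  exact: hc.
have [[psi [psi1 _]] _] := univ _ _ _ agree.
exists (wreath X), psi; split; [exact: wreath_fg | exact: wreath_vab|].
move=> x + y exy; rewrite /ker /= exy => ey.
have phiy : phi1 y = 1 by rewrite -psi1.
(* At the base point both representatives are [1]: since [y] fixes it, [y] lies in [B1], and its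
   translation is [f1 y * c2 1]. *)
have := h1 y (g0, t1, t2); rewrite phiy /= perm1 ffunE => -[].
rewrite /a1 /k1 /= -/g0 in e11 *; rewrite e11 e21 mul1g => -[qy].
rewrite -qy e11 !invg1 mulg1 => /esym/eqP; rewrite GRing.mulf_eq0 => h.
split; last by case/orP: h => /eqP.
by rewrite -[y]mulg1 -invg1 -e11; apply/q1E; rewrite e1K.
Qed.

(** * Assembling the homomorphism on the amalgam *)

Lemma quotient_proj_ker (G : groupType) (N : normalSubgroup G) (x : G) :
  quotient_proj N x = 1 -> normal_set N x.
Proof.
move=> /esym /eqquotP /set_mem.
by rewrite invg1 mul1g.
Qed.

(** With [c] generating a cyclic subgroup of finite index, [w] is a power [c ^+ (n * m)] lying in
    both subgroups. If [g ^+ k] is the [t]-th power of [c], then [g ^+ (k * (n * m))] is that of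
    [w]. *)
Lemma fin_idx_cyclic_power (G0 : groupType) (A1 A2 : set G0) :
  virtually_cyclic [set: G0] -> subgroup A1 -> subgroup A2 ->
  fin_idx A1 [set: G0] -> fin_idx A2 [set: G0] ->
  exists w, [/\ A1 w, A2 w &
    forall g, exists s t, (0 < s)%N /\ g ^+ s = zpow w t].
Proof.
move=> [C [sC _ /(fin_idxP _ sC) iC [c eC]]] s1 s2 iA1 iA2.
have [n n0 hn] := fin_idx_power c iA1; have [m m0 hm] := fin_idx_power c iA2.
exists (c ^+ (n * m)); split.
- by rewrite expgnA; apply: subgroupX.
- by rewrite mulnC expgnA; apply: subgroupX.
move=> g; have [k k0] := fin_idx_power g iC.
rewrite eC generated_zpow => -[t _ et].
exists (k * (n * m))%N, t; split; first by rewrite !muln_gt0 k0 n0.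
by rewrite expgnA -et -zpowMn GRing.mulrC zpowM.
Qed.

Lemma fin_idx_morph_preim (G0 G : groupType) (j : {multiplicative G0 -> G})
    (B : set G) : fin_idx B [set: G] -> fin_idx (j @^-1` B) [set: G0].
Proof.
move=> [T [F hF]]; exists T, (F \o j) => x y _ _ e.
by rewrite /= gmulfM gmorphV; apply: hF.
Qed.

Lemma morph_preim_subgroup (G0 G : groupType) (j : {multiplicative G0 -> G})
    (B : set G) : subgroup B -> subgroup (j @^-1` B).
Proof.
move=> sB; apply: subgroupP => [|x y bx bY]; rewrite /= ?gmorph1 ?gmorphF.
  exact: subgroup1.
exact: subgroupF.
Qed.

Lemma int_separated_normal (G : groupType) (Q : set G) :
  int_separated [set: G] Q ->
  exists (B : set G) (I : finType) (f : I -> G -> int),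
    [/\ subgroup B, forall x g, B x -> B (x ^ g), fin_idx B [set: G],
        forall i, zhom B (f i) &
        forall x, B x -> (forall i, f i x = 0%R) -> Q x].
Proof.
move=> [B [I [f [sB _ iB hf hQ]]]]; exists (core B), I, f; split.
- exact: core_subgroup.
- by move=> x g; apply: core_conj.
- exact: core_fin_idx.
- by move=> i; apply: zhom_sub (hf i); apply: core_sub.
- by move=> x /core_sub; apply: hQ.
Qed.

Lemma amalgam_separated_vab_kernel (G0 G1 G2 G : groupType)
    (j1 : {multiplicative G0 -> G1}) (j2 : {multiplicative G0 -> G2})
    (i1 : {multiplicative G1 -> G}) (i2 : {multiplicative G2 -> G})
    (Q1 : set G1) (Q2 : set G2) :
  virtually_cyclic [set: G0] -> is_amalgam j1 j2 i1 i2 ->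
  int_separated [set: G1] Q1 -> int_separated [set: G2] Q2 ->
  (forall g, Q1 (j1 g) -> g = 1) -> (forall g, Q2 (j2 g) -> g = 1) ->
  vab_kernel [set x | forall y, x = i1 y -> Q1 y].
Proof.
move=> vc am /int_separated_normal[B1 [I1 [f1 [sB1 nB1 iB1 hf1 hQ1]]]].
move=> /int_separated_normal[B2 [I2 [f2 [sB2 nB2 iB2 hf2 hQ2]]]] Q1j Q2j.
have [w [w1 w2 hw]] := fin_idx_cyclic_power vc
  (morph_preim_subgroup j1 sB1) (morph_preim_subgroup j2 sB2)
  (fin_idx_morph_preim j1 iB1) (fin_idx_morph_preim j2 iB2).
have [C1 [sC1 nC1 iC1 CB1 jC1]] := cyclic_intersection sB1 nB1 iB1 hf1 w1 hw
  (fun g bg fg => Q1j _ (hQ1 _ bg fg)).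
have [C2 [sC2 nC2 iC2 CB2 jC2]] := cyclic_intersection sB2 nB2 iB2 hf2 w2 hw
  (fun g bg fg => Q2j _ (hQ2 _ bg fg)).
have eC g : C1 (j1 g) <-> C2 (j2 g) by rewrite jC1 jC2.
have h1 i : zhom C1 (f1 i) by apply: zhom_sub (hf1 i).
have h2 i : zhom C2 (f2 i) by apply: zhom_sub (hf2 i).
(* This bound only forces membership in [C1]; it starts the induction over [I1], which may be
   empty. *)
have ker0 : vab_kernel [set x | forall y, x = i1 y -> C1 y /\ (0 : int)%R = 0%R].
  apply: (@amalgam_vab_kernel _ _ _ _ j1 j2 i1 i2 C1 C2
    (fun=> 0%R) (fun=> 0%R) (fun=> 0%R) (fun=> 1%R)) => //.
have kerI i : vab_kernel [set x | forall y, x = i1 y -> C1 y /\ f1 i y = 0%R].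
  have [we|wn] := pselect (w = 1).
    apply: (@amalgam_vab_kernel _ _ _ _ j1 j2 i1 i2 C1 C2
      (f1 i) (fun=> 0%R) (fun=> 0%R) (fun=> 1%R)) => // d x1 x2.
    move=> /jC1[k _ <-].
    by rewrite we zpow1n gmorph1 conj1g (zhom1 sC1 (h1 i)).
  have [k fk] : exists k, f2 k (j2 w) <> 0%R.
    apply: contrapT => /forallNP h; apply: wn; apply: Q2j; apply: hQ2 => // k.
    by apply: contrapT; apply: h.
  have wC1 : C1 (j1 w) by apply/jC1; exists 1%R.
  have wC2 : C2 (j2 w) by apply/jC2; exists 1%R.
  (* On the [n]-th power of [w] both sides of the balance equal [n] times the product of the two
     weights, and [c2 1] is non-zero by the choice of [k]. *)
  apply: (@amalgam_vab_kernel _ _ _ _ j1 j2 i1 i2 C1 C2 (f1 i) (f2 k)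
    (fun x => f1 i (j1 w ^ x)) (fun x => f2 k (j2 w ^ x))) => //.
    move=> d x1 x2 /jC1[n _ <-]; rewrite !gmorph_zpow !conj_zpow.
    rewrite (zhom_zpow sC1 (h1 i)); last exact: nC1.
    by rewrite (zhom_zpow sC2 (h2 k)); [lia | exact: nC2].
  by rewrite conjg1.
have kerS (s : seq I1) : vab_kernel
    [set x | forall y, x = i1 y -> C1 y /\ forall i, i \in s -> f1 i y = 0%R].
  elim: s => [|i s IH].
    by apply: vab_kernel_sub ker0 => x h y /h[].
  apply: vab_kernel_sub (vab_kernelI (kerI i) IH) => x [h h'] y exy.
  have [cy fy] := h _ exy; have [_ fs] := h' _ exy.
  by split=> // k; rewrite inE => /orP[/eqP -> //|/fs].
apply: vab_kernel_sub (kerS (enum I1)) => x h y /h[cy fy].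
by apply: hQ1 => [|i]; [apply: CB1 | apply: fy; rewrite mem_enum].
Qed.

Lemma is_amalgam_sym (G0 G1 G2 G : groupType)
    (j1 : {multiplicative G0 -> G1}) (j2 : {multiplicative G0 -> G2})
    (i1 : {multiplicative G1 -> G}) (i2 : {multiplicative G2 -> G}) :
  is_amalgam j1 j2 i1 i2 -> is_amalgam j2 j1 i2 i1.
Proof.
move=> [ij univ]; split=> [x|T f2 f1 e]; first by rewrite ij.
have [[f [e1 e2]] uniq_f] := univ T f1 f2 (fun x => esym (e x)).
by split=> [|g h h2 h1]; [exists f | apply: uniq_f].
Qed.

(** [N] is reached through its quotient, [H] and the image of [G0] through their retractions. The
    last condition gives trivial intersection with the image of [G0], on which both the gluing and
    the injectivity on [G0] rely. *)
Lemma int_separated_factor (G0 G : groupType) (j : {multiplicative G0 -> G})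
    (N : normalSubgroup G) (H : set G) :
  injective j -> virtually_cyclic [set: G0] -> virtual_retract (range j) ->
  finitely_generated [set: quotient_group N] ->
  virtually_abelian [set: quotient_group N] ->
  finitely_generated H -> virtually_abelian H -> virtual_retract H ->
  int_separated [set: G]
    [set x | [/\ normal_set N x, H x -> x = 1 & range j x -> x = 1]].
Proof.
move=> inj vc rj fgN vabN fgH vabH rH.
have sepN : int_separated [set: G] N.
  have sT : subgroup [set: G] by apply: subgroupP.
  have qM x y : [set: G] x -> [set: G] y ->
      quotient_proj N (x * y) = quotient_proj N x * quotient_proj N y.
    by move=> _ _; apply: gmulfM.
  have := int_separated_preim sT qM (fun _ _ => I)
    (int_separated_fg_vab fgN vabN).
  apply: int_separated_sub => x _ /= e; exact: quotient_proj_ker.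
have sepH := int_separated_retract rH (int_separated_fg_vab fgH vabH).
have sepj := int_separated_retract rj
  (int_separated_range inj (int_separated_vcyclic vc)).
apply: int_separated_sub (int_separatedI sepN (int_separatedI sepH sepj)).
by move=> x _ [nx [hx jx]].
Qed.

Theorem proposition6p1
  (G0 G1 G2 G : groupType)
  (j1 : {multiplicative G0 -> G1}) (j2 : {multiplicative G0 -> G2})
  (i1 : {multiplicative G1 -> G}) (i2 : {multiplicative G2 -> G})
  (j1_inj : injective j1) (j2_inj : injective j2)
  (G0_vcyclic : virtually_cyclic [set: G0])
  (G_amalgam : is_amalgam j1 j2 i1 i2)
  (N1 : normalSubgroup G1) (N2 : normalSubgroup G2) (N : normalSubgroup G)
  (GN1_fg : finitely_generated [set: quotient_group N1])
  (GN1_vab : virtually_abelian [set: quotient_group N1])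
  (GN2_fg : finitely_generated [set: quotient_group N2])
  (GN2_vab : virtually_abelian [set: quotient_group N2])
  (GN_fg : finitely_generated [set: quotient_group N])
  (GN_vab : virtually_abelian [set: quotient_group N])
  (G0_retract1 : virtual_retract (range j1))
  (G0_retract2 : virtual_retract (range j2))
  (H1 : set G1) (H2 : set G2)
  (H1_subgroup : subgroup H1) (H2_subgroup : subgroup H2)
  (H1_fg : finitely_generated H1) (H1_vab : virtually_abelian H1)
  (H2_fg : finitely_generated H2) (H2_vab : virtually_abelian H2)
  (H1_retract : virtual_retract H1) (H2_retract : virtual_retract H2) :
  exists (P : groupType) (psi : {multiplicative G -> P}),
    [/\ finitely_generated [set: P] /\ virtually_abelian [set: P],
        i1 @^-1` ker psi `<=` N1 /\ i2 @^-1` ker psi `<=` N2,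
        ker psi `<=` N &
        [/\ injective (psi \o i1 \o j1),
            {in H1 &, injective (psi \o i1)} &
            {in H2 &, injective (psi \o i2)}]].
Proof.
have sep1 := int_separated_factor j1_inj G0_vcyclic G0_retract1 GN1_fg GN1_vab
  H1_fg H1_vab H1_retract.
have sep2 := int_separated_factor j2_inj G0_vcyclic G0_retract2 GN2_fg GN2_vab
  H2_fg H2_vab H2_retract.
have tr1 g : [/\ normal_set N1 (j1 g), H1 (j1 g) -> j1 g = 1
    & range j1 (j1 g) -> j1 g = 1] -> g = 1.
  by move=> [_ _ h]; apply: j1_inj; rewrite gmorph1; apply: h; exists g.
have tr2 g : [/\ normal_set N2 (j2 g), H2 (j2 g) -> j2 g = 1
    & range j2 (j2 g) -> j2 g = 1] -> g = 1.
  by move=> [_ _ h]; apply: j2_inj; rewrite gmorph1; apply: h; exists g.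
have ker1 := amalgam_separated_vab_kernel G0_vcyclic G_amalgam sep1 sep2 tr1 tr2.
have ker2 := amalgam_separated_vab_kernel G0_vcyclic (is_amalgam_sym G_amalgam)
  sep2 sep1 tr2 tr1.
have kerN : vab_kernel N.
  exists (quotient_group N), (quotient_proj N).
  by split=> // x; apply: quotient_proj_ker.
have [P [psi [fgP vabP hker]]] := vab_kernelI kerN (vab_kernelI ker1 ker2).
exists P, psi; split=> //.
- split=> x /hker[_ [h1 h2]]; first by have [] := h1 _ erefl.
  by have [] := h2 _ erefl.
- by move=> x /hker[].
(* Elements with equal images have their quotient in the kernel, so the implications carried by the
   separated sets yield all three injectivity claims. *)
have inj_sub (K : groupType) (i : {multiplicative K -> G}) (x y : K) :
    psi (i x) = psi (i y) -> ker psi (i (x * y^-1)).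
  by move=> e; rewrite /ker /= gmorphF gmorphF e mulgV.
split.
- move=> g h /inj_sub /hker[_ [/(_ _ erefl) + _]].
  rewrite -gmorphF => /tr1; exact: divg1_eq.
- move=> x y /set_mem hx /set_mem hy /inj_sub /hker[_ [/(_ _ erefl)[_ h _] _]].
  by apply/divg1_eq/h; apply: subgroupF.
- move=> x y /set_mem hx /set_mem hy /inj_sub /hker[_ [_ /(_ _ erefl)[_ h _]]].
  by apply/divg1_eq/h; apply: subgroupF.
Qed.
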